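(* Let $p\geq3$ be a prime, $\omega=e^{2\pi i/p}$, and let $M=(m_{ij})_{i,j=0}^{p-1}$ be a circulant matrix with entries in $\mathbb Z/p\mathbb Z$. Then $U=(\omega^{m_{ij}})_{i,j=0}^{p-1}$ is a complex Hadamard matrix if and only if there exist $a,b,c\in\mathbb Z/p\mathbb Z$ with $a\neq0$ such that $m_{0j}=aj^2+bj+c$ for all $j\in\mathbb Z/p\mathbb Z$.
   Context: A complex Hadamard matrix has all entries of modulus one and pairwise orthogonal rows. $M$ circulant means $m_{ij}$ depends only on $j-i$ modulo $p$. *)

(* Defs.v *)
From HB Require Import structures.
From mathcomp Require Import all_boot all_order all_algebra all_field.
Set Implicit Arguments. Unset Strict Implicit. Unset Printing Implicit Defensive.
Import Order.TTheory GRing.Theory Num.Theory.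
Local Open Scope ring_scope.

Definition complex_hadamard (n : nat) (U : 'M[algC]_n) : Prop :=
  (forall i j, `|U i j| = 1) /\
  (forall i k : 'I_n, i != k -> \sum_(j < n) U i j * (U k j)^* = 0).

Definition circulant (R : Type) (n : nat) (M : 'M[R]_n) : Prop :=
  forall i j i' j' : 'I_n,
    ((j + n - i) %% n = (j' + n - i') %% n)%N -> M i j = M i' j'.

(* omega = e^{2 pi i / p}: p.-root (-1) is e^{i pi / p} (minimal argument). *)
Definition omega (p : nat) : algC := (p.-root (-1)) ^+ 2.

Definition expmx (p : nat) (M : 'M['F_p]_p) : 'M[algC]_p :=
  \matrix_(i, j) omega p ^+ (nat_of_ord (M i j)).

(* Main.v *)
(** Rows [i] and [k] of [U] are orthogonal iff [j |-> m_ij - m_kj] is a bijection,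
    because the only rational relation between the powers of [omega] is that
    their sum vanishes.  Writing [m_ij = f (j - i)], [U] is Hadamard iff
    [f (x + d) - f x] is a permutation of [F_p] for every [d != 0] ([f] is
    planar), and it remains to show that a planar function is quadratic.

    Let [u b] be the size of the fibre of [f] over [b], minus one; then
    [\sum u = 0] and [\sum u^2 = p - 1].  The sums of [f x ^ k] vanish for
    [k < (p - 1) / 2], so the convolution of [u] with the Legendre symbol is
    constant modulo [p]: it equals [c + p v] with [v] integral.  Parseval gives
    [p \sum v^2 = p - 1 + c^2], hence one may take [c = 1] or [c = -1], and then
    [\sum v^2 = 1]; inverting the convolution yields [|u| <= 1].  Applied to
    [f - l x], this shows that no three points of the graph of [f] are
    collinear.  Segre's argument then applies: at each [a] exactly one slope
    [t a] is not that of a secant, and comparing products of slopes gives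
    [(t a + t b) (b - a) = 2 (f b - f a)], which forces [f] to be quadratic. *)
Require Import Defs.
From HB Require Import structures.
From mathcomp Require Import all_boot all_order all_algebra all_field.
From mathcomp Require Import zify ring.
Set Implicit Arguments. Unset Strict Implicit. Unset Printing Implicit Defensive.
Import Order.TTheory GRing.Theory Num.Theory.
Local Open Scope ring_scope.

(** * Power sums over a finite field *)

Lemma natr_card_finField (F : finFieldType) : #|F|%:R = 0 :> F.
Proof.
pose s := \sum_(x : F) x.
have /eqP : s = s + #|F|%:R.
  rewrite {1}/s (reindex_inj (addIr 1)) /= big_split /= sumr_const.
  by congr (_ + _%:R); apply: eq_card.
by rewrite -subr_eq0 opprD addNKr oppr_eq0 => /eqP.
Qed.

(** For [k > 0], scaling by a nonzero [g] with [g ^+ k != 1] multiplies the sum by [g ^+ k]; such a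
    [g] exists because X^k - 1 has at most [k] roots. *)
Lemma sum_expf_eq0 (F : finFieldType) (k : nat) :
  (k < #|F|.-1)%N -> \sum_(x : F) x ^+ k = 0.
Proof.
case: k => [|k] hk.
  rewrite (eq_bigr (fun=> 1)) ?sumr_const => [|x _]; last by rewrite expr0.
  rewrite -[RHS](natr_card_finField F); congr _%:R; exact: eq_card.
have [g g0 gk] : exists2 g : F, g != 0 & g ^+ k.+1 != 1.
  apply/exists_inP; apply: contraLR hk => /exists_inPn h; rewrite -leqNgt.
  have <- : #|[set~ (0 : F)]| = #|F|.-1.
    by rewrite cardsC1.
  rewrite cardE; apply: (@max_unity_roots F k.+1) => //; last exact: enum_uniq.
  apply/allP => x; rewrite mem_enum !inE => x0; apply/unity_rootP/eqP.
  by have := h x x0; rewrite negbK.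
have /eqP : \sum_(x : F) x ^+ k.+1 = g ^+ k.+1 * \sum_(x : F) x ^+ k.+1.
  rewrite {1}(reindex_inj (mulfI g0)) /= mulr_sumr.
  by apply: eq_bigr => x _; rewrite exprMn.
rewrite -subr_eq0 -{1}[\sum_x _]mul1r -mulrBl mulf_eq0 subr_eq0 eq_sym.
by rewrite (negPf gk) => /eqP.
Qed.

Lemma expf_card1 (F : finFieldType) (x : F) : x != 0 -> x ^+ #|F|.-1 = 1.
Proof.
move=> x0; apply: (mulfI x0); rewrite mulr1 -exprS prednK ?expf_card //.
by apply/card_gt0P; exists 0.
Qed.

Lemma sum_expf_card1 (F : finFieldType) :
  \sum_(x : F) x ^+ #|F|.-1 = -1.
Proof.
have F1 : (1 < #|F|)%N := finNzRing_gt1 F.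
rewrite (bigD1 0) //= expr0n; have -> : (#|F|.-1 == 0)%N = false by case: #|F| F1 => [|[]].
rewrite add0r (eq_bigr (fun=> 1)) => [|x x0]; last exact: expf_card1.
rewrite sumr_const; apply/eqP; rewrite -subr_eq0 opprK -mulrSr.
rewrite (eq_card (B := predC1 0)) // cardC1 prednK ?natr_card_finField //.
exact: ltnW.
Qed.

(** * Moments and fibre sizes of planar functions *)

Definition planar (F : finFieldType) (f : F -> F) : Prop :=
  forall d, d != 0 -> injective (fun x => f (x + d) - f x).

Lemma sum_diff_pairs (F : finFieldType) (R : nmodType) (f : F -> F) (g : F -> F -> R) :
  \sum_x \sum_y g x y = \sum_d \sum_x g (x + d) x.
Proof.
rewrite [RHS]exchange_big [LHS]exchange_big /=; apply: eq_bigr => y _.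
by rewrite (reindex_inj (addrI y)).
Qed.

Section Planar.
Variables (p : nat) (hp : prime p) (hp3 : (3 <= p)%N).
Local Notation F := 'F_p.
Let m := (p.-1)./2.

Let pm : (m + m = p.-1)%N.
Proof.
rewrite addnn; apply: even_halfK.
by case: (even_prime hp) hp3 => [->//|]; case: (p) => //= n.
Qed.

Let cardF : #|F| = p. Proof. exact: card_Fp. Qed.

Let sumF k : (k < p.-1)%N -> \sum_(x : F) x ^+ k = 0.
Proof. by move=> hk; apply: sum_expf_eq0; rewrite cardF. Qed.

Let expF (x : F) : x != 0 -> x ^+ p.-1 = 1.
Proof. by move=> x0; rewrite -[RHS](expf_card1 x0) cardF. Qed.

Let sumF1 : \sum_(x : F) x ^+ p.-1 = -1.
Proof. by rewrite -[RHS](sum_expf_card1 F) cardF. Qed.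

Lemma bin_Fp_neq0 (n k : nat) : (n < p)%N -> (k <= n)%N -> 'C(n, k)%:R != 0 :> F.
Proof.
move=> np kn; rewrite -(dvdn_pcharf (pchar_Fp hp)).
have : ~~ (p %| n`!)%N.
  elim: n np {k kn} => [|n IH] np; first by rewrite fact0 dvdn1; case: eqP hp => // ->.
  rewrite factS Euclid_dvdM // negb_or IH ?(ltnW np) // andbT.
  by apply/negP => /dvdn_leq; lia.
apply: contra => h; rewrite -(bin_fact kn); exact: dvdn_mulr.
Qed.

Section Moments.
Variables (f : F -> F) (hf : planar f).

(** For each difference [d != 0], planarity turns the inner sum into the sum of all [k]-th powers;
    [d = 0] contributes [#|F|] equal terms, hence 0. *)
Lemma planar_pow_sum (k : nat) : (k < p.-1)%N ->
  \sum_x \sum_y (f x - f y) ^+ k = 0.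
Proof.
move=> hk; rewrite sum_diff_pairs // big1 // => d _.
have [->|d0] := eqVneq d 0.
  under eq_bigr do rewrite addr0 subrr.
  rewrite sumr_const (_ : #|_| = #|F|); last exact: eq_card.
  by rewrite -mulr_natr natr_card_finField mulr0.
by rewrite -[RHS](sumF hk) [RHS](reindex_inj (hf d0)).
Qed.

(* Only the middle term of the binomial expansion of [(f x - f y) ^+ (2 * k)]
   involves no lower moment, so the square of the [k]-th moment vanishes. *)
Lemma planar_moment (k : nat) : (k < m)%N -> \sum_x f x ^+ k = 0.
Proof.
have [n] := ubnP k; elim: n k => // n IH k /ltnSE kn km.
have h2 : (k + k < p.-1)%N by lia.
have := planar_pow_sum h2.
pose S i := \sum_x f x ^+ i.
have -> : \sum_x \sum_y (f x - f y) ^+ (k + k) =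
   \sum_(i < (k + k).+1) (-1) ^+ i * (S (k + k - i)%N * S i) *+ 'C(k + k, i).
  under eq_bigr => x _ do under eq_bigr => y _ do rewrite exprBn.
  under eq_bigr => x _ do rewrite exchange_big /=.
  rewrite exchange_big /=; apply: eq_bigr => i _.
  rewrite /S mulr_suml mulr_sumr -sumrMnl; apply: eq_bigr => x _.
  rewrite mulr_sumr mulr_sumr -sumrMnl; apply: eq_bigr => y _.
  by rewrite mulrA.
have hk : (k < (k + k).+1)%N by lia.
rewrite (bigD1 (Ordinal hk)) //= big1 ?addr0 => [|i].
  rewrite addnK -mulr_natr => /eqP; rewrite !mulf_eq0 signr_eq0 /= orbb.
  rewrite (negPf (bin_Fp_neq0 _ _)) ?orbF; try lia.
  by move/eqP.
rewrite -val_eqE /= => ik.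
have [ki|ki] := ltnP k i.
  by have hi := ltn_ord i; rewrite /S IH; [rewrite mul0r mulr0 mul0rn|lia|lia].
by have -> : S i = 0; [apply: IH; lia | rewrite !mulr0 mul0rn].
Qed.

(** The lower moments vanish, so only the [m]-th one survives and the value is independent of
    [b]. *)
Lemma sum_sub_pow (b : F) : \sum_x (b - f x) ^+ m = (-1) ^+ m * \sum_x f x ^+ m.
Proof.
under eq_bigr do rewrite exprBn.
rewrite exchange_big big_ord_recr /= big1 ?add0r => [|i _].
  by rewrite subnn binn mulr_sumr; apply: eq_bigr => x _; rewrite mulr1.
by rewrite sumrMnl -mulr_sumr planar_moment // mulr0 mul0rn.
Qed.

Definition fibre (b : F) : nat := #|[set x | f x == b]|.
Definition excess (b : F) : int := (fibre b)%:Z - 1.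

Lemma sum_excess (R : pzRingType) (phi : F -> R) :
  \sum_b (excess b)%:~R * phi b = \sum_x phi (f x) - \sum_b phi b.
Proof.
rewrite [X in _ = X - _](partition_big f predT) //= -sumrB; apply: eq_bigr => b _.
rewrite /excess intrB mulrBl mul1r; congr (_ - _).
rewrite (eq_bigr (fun=> phi b)) => [|x /eqP-> //].
by rewrite sumr_const /fibre cardsE mulr_natl.
Qed.

Lemma sum_excess1 : \sum_b excess b = 0.
Proof.
have := @sum_excess int (fun=> 1); rewrite subrr.
by under eq_bigr do rewrite mulr1 intz.
Qed.

(** This counts the pairs with [f x = f y]: [p] of them have difference 0, and by planarity each
    nonzero difference occurs exactly once. *)
Lemma sum_fibre : \sum_x (fibre (f x))%:Z = (p + p.-1)%N%:Z.
Proof.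
have -> : \sum_x (fibre (f x))%:Z = \sum_x \sum_y (f x == f y)%:Z.
  apply: eq_bigr => x _; rewrite /fibre -sum1_card big_mkcond /=.
  rewrite (big_morph Posz PoszD (erefl _)).
  by apply: eq_bigr => y _; rewrite inE eq_sym; case: eqP.
rewrite sum_diff_pairs // (bigD1 0) //= PoszD; congr (_ + _).
  under eq_bigr do rewrite addr0 eqxx.
  by rewrite sumr_const natz; congr Posz; rewrite -[RHS]cardF; apply: eq_card.
rewrite (eq_bigr (fun=> 1)) => [|d d0].
  by rewrite sumr_const natz (eq_card (B := predC1 0)) // cardC1 cardF.
have [g gK Kg] := injF_bij (hf d0).
rewrite (bigD1 (g 0)) //= -subr_eq0 Kg eqxx big1 // => x.
rewrite -subr_eq0 => xg.
case: eqP => // h; case/negP: xg; rewrite subr_eq0; apply/eqP.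
by have := gK x; rewrite /= h subrr => ->.
Qed.

Lemma sum_excess_sqr : \sum_b excess b ^+ 2 = p.-1%:Z.
Proof.
under eq_bigr do rewrite expr2 -{1}[excess _]intz.
rewrite sum_excess sum_excess1 subr0 sumrB sum_fibre sumr_const.
rewrite (eq_card (B := F)) // cardF; lia.
Qed.

End Moments.

(** * The integer-valued Legendre symbol *)

Lemma intr_Fp_eq0 (z : int) : (z%:~R == 0 :> F) = (p %| z)%Z.
Proof. by rewrite (dvdz_pcharf (pchar_Fp hp)). Qed.

Lemma intr_Fp_inj_small (z : int) : z%:~R = 0 :> F -> `|z| < p%:Z -> z = 0.
Proof.
move/eqP; rewrite intr_Fp_eq0 => /dvdzP[q ->]; rewrite normrM.
have [->|q0 h] := eqVneq q 0; first by rewrite mul0r.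
have : 1 <= `|q| by rewrite -gtz0_ge1 normr_gt0.
by nia.
Qed.

(** Euler's criterion serves as definition, so that reduction modulo [p] gives back [x ^+ m]. *)
Definition legendre (x : F) : int :=
  if x ^+ m == 0 then 0 else if x ^+ m == 1 then 1 else -1.

Lemma legendre_intr (x : F) : (legendre x)%:~R = x ^+ m.
Proof.
rewrite /legendre; case: eqVneq => [->//|xm0]; case: eqVneq => [->//|x1].
have : (x ^+ m) ^+ 2 == 1.
  rewrite -exprM muln2 -addnn pm expF //.
  by apply: contra xm0 => /eqP->; rewrite expr0n; case: (m) pm => //; lia.
by rewrite sqrf_eq1 (negPf x1) /= => /eqP->.
Qed.

Lemma normr_legendre (x : F) : `|legendre x| = (x != 0)%:Z.
Proof.
rewrite /legendre expf_eq0 (_ : (0 < m)%N = true); last by apply/idP; lia.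
by case: (x == 0) => //=; case: ifP.
Qed.

Lemma sum_normr_legendre (a : F) : \sum_b `|legendre (b - a)| = p.-1%:Z.
Proof.
under eq_bigr do rewrite normr_legendre subr_eq0.
rewrite -(big_morph Posz PoszD (erefl _)) -[in RHS]cardF -(cardC1 a) -sum1_card.
by rewrite [in RHS]big_mkcond; congr Posz; apply: eq_bigr.
Qed.

Lemma sum_legendre (a : F) : \sum_b legendre (b - a) = 0.
Proof.
apply: intr_Fp_inj_small.
  rewrite rmorph_sum /=; under eq_bigr do rewrite legendre_intr.
  rewrite (reindex_inj (addIr a)) /=; under eq_bigr do rewrite addrK.
  by apply: sumF; lia.
by apply: le_lt_trans (ler_norm_sum _ _ _) _; rewrite sum_normr_legendre; lia.
Qed.

(** For [a != c], expanding modulo [p] leaves only the term of degree [p - 1], so the sum is -1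
    modulo [p]. The terms at [a] and [c] vanish, which bounds it by [p - 2] in absolute value and
    forces equality. *)
Lemma sum_legendre_mul (a c : F) :
  \sum_b legendre (b - a) * legendre (b - c) = p%:Z * (a == c)%:Z - 1.
Proof.
case: eqP => [<-|/eqP ac].
  under eq_bigr => b _.
    rewrite -expr2 -real_normK ?num_real // normr_legendre.
    rewrite (_ : _ ^+ 2 = (b - a != 0)%:Z); last by case: eqP.
    rewrite -normr_legendre; over.
  by rewrite sum_normr_legendre; lia.
apply/eqP; rewrite -subr_eq0; apply/eqP/intr_Fp_inj_small.
  rewrite mulr0 sub0r opprK intrD rmorph_sum /=.
  under eq_bigr do rewrite rmorphM /= !legendre_intr.
  rewrite (reindex_inj (addIr a)) /=.
  under eq_bigr => b _ do rewrite addrK -addrA [in X in _ * X]exprDn mulr_sumr.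
  rewrite exchange_big big_ord_recl /= [X in _ + X + _]big1 ?addr0 => [|i _].
    under eq_bigr => b _ do rewrite /= subn0 expr0 mulr1 bin0 mulr1n -exprD pm.
    by rewrite sumF1 addNr.
  under eq_bigr => b _ do rewrite -mulr_natr !mulrA -exprD.
  by rewrite -!mulr_suml sumF ?mul0r // -pm /bump /=; have := ltn_ord i; lia.
rewrite mulr0 sub0r opprK.
have h : `|\sum_b legendre (b - a) * legendre (b - c)| <= p%:Z - 2.
  apply: le_trans (ler_norm_sum _ _ _) _.
  have -> : p%:Z - 2 = \sum_b `|legendre (b - a)| - 1 by rewrite sum_normr_legendre; lia.
  rewrite (bigD1 c) //= [X in _ <= X - _](bigD1 c) //= subrr normrM.
  rewrite !normr_legendre eqxx mulr0 subr_eq0 eq_sym ac.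
  rewrite addrAC subrr !add0r; apply: ler_sum => b _; rewrite normrM !normr_legendre.
  by case: eqP; case: eqP.
by move: h; set z := \sum_b _; lia.
Qed.

(** * Fibre bound by convolution with the Legendre symbol *)

Lemma planar_excess_le1 (f : F -> F) : planar f -> forall b, excess f b <= 1.
Proof.
move=> hf b0; pose u := excess f.
pose w b := \sum_a u a * legendre (b - a).
(* Modulo [p], [w b] is the sum of the [(b - f x) ^+ m], which does not depend on [b]; [c0] lifts
   its value to an integer. *)
have [c0 wc0] : exists c : int, forall b, (w b - c)%:~R = 0 :> F.
  have [c hc] : exists c : int, c%:~R = (-1) ^+ m * \sum_x f x ^+ m :> F.
    exists (Posz (nat_of_ord ((-1) ^+ m * \sum_x f x ^+ m : F))).
    by rewrite -pmulrn natr_Zp.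
  exists c => b; rewrite intrB hc -(sum_sub_pow hf b) rmorph_sum /=.
  under eq_bigr do rewrite intrM legendre_intr.
  rewrite (sum_excess f (fun a => (b - a) ^+ m)) addrAC subrr sub0r.
  rewrite (reindex_inj (@subrI _ b)) /=.
  under eq_bigr do rewrite subKr.
  by rewrite sumF ?oppr0 //; lia.
have sumw : \sum_b w b = 0.
  rewrite exchange_big big1 // => a _.
  by rewrite -mulr_sumr sum_legendre mulr0.
(* Translates of the symbol are orthogonal up to the constant -1, whose contribution vanishes
   because [u] sums to 0. *)
have wK c : \sum_b w b * legendre (b - c) = p%:Z * u c.
  under eq_bigr do rewrite mulr_suml.
  rewrite exchange_big /=.
  under eq_bigr => a _.
    under eq_bigr do rewrite -mulrA.
    rewrite -mulr_sumr sum_legendre_mul mulrBr mulr1; over.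
  rewrite sumrB sum_excess1 subr0 (bigD1 c) //= eqxx mulr1 big1 ?addr0 1?mulrC //.
  by move=> a /negPf->; rewrite !mulr0.
have sumw2 : \sum_b w b ^+ 2 = p%:Z * p.-1%:Z.
  under eq_bigr => b _ do rewrite expr2 {2}/w mulr_sumr.
  rewrite exchange_big /= -(sum_excess_sqr hf) mulr_sumr; apply: eq_bigr => a _.
  under eq_bigr do rewrite mulrCA.
  by rewrite -mulr_sumr wK -/(u a); ring.
have key (c : int) : (forall b, (w b - c)%:~R = 0 :> F) ->
   exists v : F -> int, (forall b, w b = c + p%:Z * v b) /\
     p%:Z * \sum_b v b ^+ 2 = p%:Z - 1 + c ^+ 2.
  move=> h; pose v b := ((w b - c) %/ p%:Z)%Z; exists v.
  have hv b : w b = c + p%:Z * v b.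
    by rewrite mulrC divzK ?subrKC // -intr_Fp_eq0 h.
  split=> //.
  have p0 : p%:Z != 0 by lia.
  have sum1c (c' : int) : \sum_(b : F) c' = p%:Z * c'.
    by rewrite sumr_const (eq_card (B := F)) // cardF -mulr_natl natz.
  have sv : \sum_b v b = - c.
    apply: (mulfI p0); move: sumw; rewrite (eq_bigr _ (fun b _ => hv b)) big_split /=.
    by rewrite sum1c -mulr_sumr => /eqP; rewrite addrC addr_eq0 => /eqP->; rewrite mulrN.
  apply: (mulfI p0); move: sumw2.
  rewrite (eq_bigr (fun b => c ^+ 2 + (2 * c * p%:Z) * v b + p%:Z ^+ 2 * v b ^+ 2)).
    rewrite !big_split /= -!mulr_sumr sv sum1c; set s := \sum_b _ => h1.
    have -> : p%:Z - 1 = p.-1%:Z by lia.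
    by rewrite mulrDr -h1; ring.
  by move=> b _; rewrite hv; ring.
(* Parseval shows that [c0 ^+ 2] is 1 modulo [p], so 1 or -1 lies in the residue class of [c0] and
   can replace it. *)
have [c [c1 wc]] : exists c : int, c ^+ 2 = 1 /\ forall b, (w b - c)%:~R = 0 :> F.
  have [v [_ hv]] := key _ wc0.
  have : (c0%:~R : F) ^+ 2 == 1.
    rewrite -subr_eq0 -rmorphXn -(intrB _ _ 1) intr_Fp_eq0; apply/dvdzP.
    by exists (\sum_b v b ^+ 2 - 1); rewrite mulrBl [_ * p%:Z]mulrC hv; ring.
  rewrite sqrf_eq1 => /orP[] /eqP hc; [exists 1|exists (-1)]; split=> // b.
    by rewrite -(wc0 b) !intrB hc.
  by rewrite -(wc0 b) !intrB hc.
have [v [wv hv]] := key _ wc.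
have sv : \sum_b v b ^+ 2 = 1.
  have p0 : p%:Z != 0 by lia.
  by apply: (mulfI p0); rewrite hv c1 subrK mulr1.
have -> : excess f b0 = \sum_b v b * legendre (b - b0).
  have p0 : p%:Z != 0 by lia.
  apply: (mulfI p0); rewrite -wK mulr_sumr.
  rewrite (eq_bigr _ (fun b _ => congr1 (fun z => z * _) (wv b))).
  under eq_bigr do rewrite mulrDl -mulrA.
  by rewrite big_split /= -mulr_sumr sum_legendre mulr0 add0r.
(* As the symbol is 0, 1 or -1, an integer [v b] times it is at most [v b ^+ 2]. *)
rewrite -sv; apply: ler_sum => b _.
by rewrite /legendre; case: ifP => _; [|case: ifP => _]; nia.
Qed.

End Planar.

(** * Collinear triples on the graph *)

Definition no_three_collinear (F : fieldType) (f : F -> F) : Prop :=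
  forall x y z, x != y -> x != z -> y != z ->
    (f y - f x) * (z - x) != (f z - f x) * (y - x).

(** Subtracting the linear map of slope [l] keeps planarity and would put three collinear points
    into one fibre, against the bound of two. *)
Lemma planar_no_three_collinear (p : nat) (f : 'F_p -> 'F_p) :
  prime p -> (3 <= p)%N -> planar f -> no_three_collinear f.
Proof.
move=> hp hp3 hf x y z xy xz yz; apply/eqP => hcol.
have yx0 : y - x != 0 by rewrite subr_eq0 eq_sym.
pose l := (f y - f x) / (y - x).
pose g := fun t => f t - l * t.
have hg : planar g.
  move=> d d0 u v; rewrite /g => huv; apply: (hf d d0).
  have -> w : f (w + d) - f w =
      f (w + d) - l * (w + d) - (f w - l * w) + l * d by ring.
  by rewrite huv; ring.
have gy : g y = g x by rewrite /g /l; field.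
have gz : g z = g x.
  have hz : f z - f x = l * (z - x).
    by rewrite /l mulrAC hcol mulfK.
  by apply/eqP; rewrite -subr_eq0 /g -[f z](subrK (f x)) hz; apply/eqP; ring.
have := planar_excess_le1 hp hp3 hg (g x).
have : (#|[set x; y; z]| <= fibre g (g x))%N.
  apply/subset_leq_card/subsetP => t; rewrite !inE.
  by move=> /orP[/orP[]|] /eqP->; rewrite ?gy ?gz.
rewrite /excess setUC cardsU1 cards2 !inE xy ![z == _]eq_sym (negPf xz) (negPf yz) /=.
by lia.
Qed.

(** * Segre's tangent argument *)

Section Tangents.
Variables (F : finFieldType) (f : F -> F) (hf : no_three_collinear f).

(* Secant slopes from [a], with the value [t] at [a]; injectivity of [slopes a t]
   characterizes [t] as the missing, i.e. tangent, slope. *)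
Definition slopes (a t x : F) : F := if x == a then t else (f x - f a) / (x - a).

(** The [#|F| - 1] secant slopes at [a] are distinct, so exactly one value is left over. *)
Lemma tangent_exists (a : F) : exists t, injective (slopes a t).
Proof.
pose s x := (f x - f a) / (x - a).
have s_inj : {in [set~ a] &, injective s}.
  move=> x y; rewrite !inE => xa ya hs; apply/eqP/negPn/negP => xy.
  have xa0 : x - a != 0 by rewrite subr_eq0.
  have ya0 : y - a != 0 by rewrite subr_eq0.
  have /eqP[] : (f x - f a) * (y - a) != (f y - f a) * (x - a).
    by apply: hf => //; rewrite eq_sym.
  rewrite -[f x - f a](divfK xa0) -[f y - f a](divfK ya0) -/(s x) -/(s y) hs.
  by ring.
have [t ht] : exists t, t \notin s @: [set~ a].
  apply/existsP; rewrite -negb_forall; apply/negP => /forallP h.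
  have := card_in_imset s_inj; rewrite (_ : _ @: _ = setT); last first.
    by apply/setP => x; rewrite inE; apply: h.
  rewrite cardsT cardsC1; have := finNzRing_gt1 F.
  by case: #|F| => // n _ /eqP; rewrite -[_ == _]/(n.+1 == n)%N (gtn_eqF (ltnSn n)).
have hs x : x != a -> s x != t.
  by move=> xa; apply: contraNneq ht => <-; apply: imset_f; rewrite !inE.
exists t => x y; rewrite /slopes -/(s x) -/(s y).
have [->|xa] := eqVneq x a; have [->|ya] := eqVneq y a => //.
- by move=> h; case: (elimN eqP (hs _ ya)).
- by move=> h; case: (elimN eqP (hs _ xa)).
- by move=> h; apply: s_inj => //; rewrite !inE.
Qed.

Lemma prod_sub_neq (c : F) : \prod_(x | x != c) (x - c) = \prod_(x : F | x != 0) x.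
Proof.
rewrite (reindex_inj (addIr c)) /=; apply: eq_big => [x|x _]; last by rewrite addrK.
by rewrite -subr_eq0 addrK.
Qed.

(* With [s] the slope of the secant [ab], both [slopes a t x - s] ([x != b]) and
   [x - a] ([x != a]) range over the nonzero elements of the field. *)
Lemma segre_prod (a b t : F) : a != b -> injective (slopes a t) ->
  (\prod_(x : F | x != 0) x) ^+ 2 =
  (t * (b - a) - (f b - f a)) * \prod_(x | (x != a) && (x != b))
    (f x - f a - (f b - f a) / (b - a) * (x - a)).
Proof.
move=> ab ht; set s := _ / _; have ba : b - a != 0 by rewrite subr_eq0 eq_sym.
have sb : slopes a t b = s by rewrite /slopes eq_sym (negPf ab).
rewrite expr2 -{1}(prod_sub_neq s) -(prod_sub_neq a) (reindex_inj ht) /=.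
rewrite (eq_bigl (fun x => x != b)) => [|x]; last first.
  by rewrite -{1}sb (inj_eq ht).
rewrite (bigD1 a) //= [X in _ * X](bigD1 b) 1?eq_sym //= {1}/slopes eqxx.
rewrite mulrACA (eq_bigl (fun x => (x != a) && (x != b))) => [|x]; last exact: andbC.
rewrite -big_split /=; congr (_ * _).
  by rewrite mulrBl /s divfK.
apply: eq_bigr => x /andP[xa xb].
by rewrite /slopes (negPf xa) mulrBl divfK // subr_eq0.
Qed.

(** The long product in [segre_prod] depends only on the line through the two points, so it is the
    same from [a] and from [b] and cancels. *)
Lemma segre_tangents (a b ta tb : F) : a != b ->
  injective (slopes a ta) -> injective (slopes b tb) ->
  (ta + tb) * (b - a) = 2%:R * (f b - f a).
Proof.
move=> ab hta htb; have ba : b != a by rewrite eq_sym.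
have W0 : (\prod_(x : F | x != 0) x) ^+ 2 != 0.
  by rewrite expf_neq0 //; apply/prodf_neq0.
have hab := segre_prod ab hta; have hba := segre_prod ba htb.
have {}hba : (\prod_(x : F | x != 0) x) ^+ 2 =
  (tb * (a - b) - (f a - f b)) * \prod_(x | (x != a) && (x != b))
    (f x - f a - (f b - f a) / (b - a) * (x - a)).
  rewrite {}hba; congr (_ * _); apply: eq_big => [x|x _]; first exact: andbC.
  by field; rewrite !subr_eq0 ab ba.
move: W0 hba; rewrite hab mulf_eq0 negb_or => /andP[_ P0] /(mulIf P0) h.
have {}h : ta * (b - a) = tb * (a - b) - (f a - f b) + (f b - f a).
  by rewrite -h subrK.
by rewrite mulrDl h; ring.
Qed.

Lemma no_three_collinear_quadratic : 2%:R != 0 :> F ->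
  exists a b c, forall x, f x = a * x ^+ 2 + b * x + c.
Proof.
move=> two; have [t0 h0] := tangent_exists 0; have [t1 h1] := tangent_exists 1.
(* The tangent slope at [x] will be [t0 + (t1 - t0) * x]; these are the coefficients of its formal
   antiderivative. *)
exists ((t1 - t0) / 2%:R), t0, (f 0) => x.
have [->|x0] := eqVneq x 0; first by ring.
have [t ht] := tangent_exists x.
have a01 : 0 != 1 :> F by rewrite eq_sym oner_eq0.
have e0 : f x = f 0 + (t0 + t) * x / 2%:R.
  have a0x : 0 != x by rewrite eq_sym.
  by have := segre_tangents a0x h0 ht; rewrite subr0 => ->; field.
have e1 : f 1 = f 0 + (t0 + t1) / 2%:R.
  by have := segre_tangents a01 h0 h1; rewrite subr0 mulr1 => ->; field.
suff tx : t = t0 + (t1 - t0) * x by rewrite e0 tx; field.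
have [x1|x1] := eqVneq x 1.
  move: ht; rewrite {}x1 => ht; have := segre_tangents a01 h0 ht.
  rewrite -(segre_tangents a01 h0 h1) subr0 !mulr1 => /addrI->.
  by rewrite subrKC.
have := segre_tangents (_ : 1 != x) h1 ht; rewrite eq_sym => /(_ x1).
rewrite e0 e1 => h; have {}h : (t1 + t) * (x - 1) = (t0 + t) * x - (t0 + t1).
  by rewrite h; field.
apply/eqP; rewrite -subr_eq0; apply/eqP.
have -> : t - (t0 + (t1 - t0) * x) = (t0 + t) * x - (t0 + t1) - (t1 + t) * (x - 1).
  by ring.
by rewrite h subrr.
Qed.

End Tangents.

(** * Roots of unity and the Hadamard condition *)

Lemma prim_omega (p : nat) : prime p -> (3 <= p)%N -> p.-primitive_root (omega p).
Proof.
move=> hp hp3; have p0 := prime_gt0 hp.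
have op : omega p ^+ p = 1 by rewrite -exprM mulnC exprM rootCK // sqrrN expr1n.
have [q hq /(primeP hp).2 /orP[] /eqP qp] := prim_order_exists p0 op; last by rewrite qp in hq.
move: (prim_expr_order hq); rewrite qp expr1 /omega => /eqP.
(* Order 1 would make the chosen root 1 or -1; the former is no [p]-th root of -1, and [p.-root] is
   never negative. *)
rewrite sqrf_eq1 => /orP[] /eqP h; exfalso.
  have := rootCK p0 (-1 : algC); rewrite h expr1n => /eqP.
  by rewrite eq_sym -subr_eq0 -opprD oppr_eq0 (pnatr_eq0 _ 2).
by have := rootC_lt0 (-1 : algC) (prime_gt1 hp); rewrite h ltrN10.
Qed.

(* The minimal polynomial of [z] over the rationals is [1 + X + ... + X^(p-1)],
   so all residues are attained equally often. *)
Lemma vanishing_sum_injective (p : nat) (z : algC) (T : finType) (g : T -> 'F_p) :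
  prime p -> p.-primitive_root z -> #|T| = p ->
  \sum_j z ^+ nat_of_ord (g j) = 0 -> injective g.
Proof.
move=> hp hz cT h0; have p0 := prime_gt0 hp; have p1 := prime_gt1 hp.
have gp j : (g j < p)%N by rewrite -[X in (_ < X)%N](Fp_cast hp).
pose P : {poly rat} := \sum_j 'X^(nat_of_ord (g j)).
pose Phi : {poly rat} := \sum_(i < p) 'X^i.
(* The multiple of [Phi] cancels the coefficient of degree [p - 1], so [Q] vanishes at [z] with
   degree below that of the minimal polynomial. *)
pose Q := P - P`_p.-1 *: Phi.
have coefPhi k : Phi`_k = (k < p)%N%:R.
  rewrite coef_sum; under eq_bigr do rewrite coefXn.
  have [kp|kp] := ltnP k p.
    rewrite (bigD1 (Ordinal kp)) //= eqxx big1 ?addr0 // => i.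
    by rewrite -val_eqE /= eq_sym => /negPf->.
  by rewrite big1 // => i _; rewrite gtn_eqF // (leq_trans (ltn_ord i)).
have coefP k : P`_k = #|[pred j | nat_of_ord (g j) == k]|%:R.
  rewrite coef_sum -sum1_card natr_sum [RHS]big_mkcond /=.
  by apply: eq_bigr => j _; rewrite coefXn eq_sym inE; case: eqP.
have Q0 : Q = 0.
  have [q [hq qmon hroot]] := minCpolyP z.
  have sq : size q = p.
    have : size (minCpoly z) = p.
      by rewrite (minCpoly_cyclotomic hz) size_cyclotomic totient_prime // prednK.
    by rewrite hq size_map_poly.
  have z1 : z != 1.
    apply: contraTneq hz => ->; apply/negP => /prim_order_dvd/(_ 1%N).
    by rewrite expr1 eqxx dvdn1; case: eqP p1 => // ->.
  have qQ : q %| Q.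
    rewrite -hroot rootE /Q rmorphB /= linearZ /= !rmorph_sum /=.
    rewrite hornerD hornerN hornerZ !horner_sum.
    under eq_bigr do rewrite map_polyXn hornerXn.
    under [X in _ - _ * X]eq_bigr do rewrite map_polyXn hornerXn.
    rewrite h0 sub0r oppr_eq0 mulf_eq0; apply/orP; right.
    rewrite -(mulrI_eq0 _ (mulfI (_ : z - 1 != 0))) ?subr_eq0 //.
    by rewrite -subrX1 prim_expr_order ?subrr.
  apply/eqP; apply: contraLR p1 => Qn0; have := dvdp_leq Qn0 qQ.
  rewrite sq => /leq_trans/(_ (_ : size Q <= p.-1)%N) => hle.
  suff /hle : (size Q <= p.-1)%N by move: p0; case: (p) => // n _; rewrite ltnn.
  apply/leq_sizeP => j; rewrite leq_eqVlt => /orP[/eqP<-|jp].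
    by rewrite coefB coefZ coefPhi prednK // leqnn mulr1 subrr.
  have pj : (p <= j)%N by move: jp; rewrite prednK.
  rewrite coefB coefZ coefPhi ltnNge pj mulr0 subr0 coefP eq_card0 // => i.
  by rewrite inE; apply/negbTE; rewrite neq_ltn (leq_trans (gp i)).
have card_const k : (k < p)%N ->
    #|[pred j | nat_of_ord (g j) == k]| = #|[pred j | nat_of_ord (g j) == p.-1]|.
  move=> kp; apply/eqP; rewrite -(eqr_nat rat) -!coefP; apply/eqP.
  have := congr1 (fun R : {poly rat} => R`_k) Q0; rewrite coef0 coefB coefZ coefPhi kp mulr1.
  by move/eqP; rewrite subr_eq0 => /eqP.
have card1 : #|[pred j | nat_of_ord (g j) == p.-1]| = 1%N.
  apply/eqP; rewrite -(eqn_pmul2l p0) muln1 -[X in _ == X]cT -[X in _ == X]sum1_card.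
  rewrite (partition_big (fun j => Ordinal (gp j)) predT) //=.
  rewrite (eq_bigr (fun=> #|[pred j | nat_of_ord (g j) == p.-1]|)); last first.
    move=> i _; rewrite sum1_card -(card_const i (ltn_ord i)).
    by apply: eq_card => j; rewrite !inE.
  by rewrite sum_nat_const card_ord.
move=> x y gxy; have /card_le1_eqP : (#|[pred j | nat_of_ord (g j) == g x]| <= 1)%N.
  by rewrite card_const ?card1.
by apply; rewrite inE ?gxy.
Qed.

Lemma expr_FpD (p : nat) (z : algC) (x y : 'F_p) : prime p -> p.-primitive_root z ->
  z ^+ nat_of_ord (x + y) = z ^+ nat_of_ord x * z ^+ nat_of_ord y.
Proof.
move=> hp hz; have zmod n : z ^+ (n %% (Zp_trunc (pdiv p)).+2) = z ^+ n.
  by rewrite Fp_cast // prim_expr_mod.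
by rewrite -exprD -[RHS]zmod.
Qed.

Lemma sum_expr_Fp (p : nat) (z : algC) : prime p -> p.-primitive_root z ->
  \sum_(x : 'F_p) z ^+ nat_of_ord x = 0.
Proof.
move=> hp hz; set S := \sum_x _.
have : S = S * z.
  rewrite {1}/S (reindex_inj (addIr 1)) mulr_suml; apply: eq_bigr => x _.
  by rewrite (expr_FpD _ _ hp hz) expr1.
move/eqP; rewrite -subr_eq0 -{1}[S]mulr1 -mulrBr mulf_eq0 => /orP[/eqP//|].
rewrite subr_eq0 eq_sym -(expr0 z) -{1}(expr1 z) (eq_prim_root_expr hz).
by rewrite mod0n modn_small ?prime_gt1.
Qed.

(** Entries have modulus one, so the inner product of two rows is a sum of powers of [omega p]
    indexed by entry differences; it vanishes exactly when these run through all residues. *)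
Lemma complex_hadamard_expmx (p : nat) (M : 'M['F_p]_p) : prime p -> (3 <= p)%N ->
  complex_hadamard (expmx M) <->
  forall i k, i != k -> injective (fun j => M i j - M k j).
Proof.
move=> hp hp3; have hz := prim_omega hp hp3; set z := omega p in hz.
have z1 : `|z| = 1.
  apply/eqP; rewrite -(pexpr_eq1 (prime_gt0 hp)) ?normr_ge0 //.
  by rewrite -normrX prim_expr_order // normr1.
have zn n : `|z ^+ n| = 1 by rewrite normrX z1 expr1n.
have zz i k j : expmx M i j * (expmx M k j)^* = z ^+ nat_of_ord (M i j - M k j).
  rewrite !mxE -/z -[in LHS](subrK (M k j) (M i j)) (expr_FpD (M i j - M k j) (M k j) hp hz) -mulrA.
  by rewrite -normCK zn expr1n mulr1.
split=> [[_ h] i k ik|h].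
  apply: (vanishing_sum_injective hp hz (card_ord p)).
  by rewrite -[RHS](h i k ik); apply: eq_bigr => j _; rewrite zz.
split=> [i j|i k ik]; first by rewrite mxE zn.
rewrite (eq_bigr _ (fun j _ => zz i k j)) -[RHS](sum_expr_Fp hp hz).
have [g' gK Kg] : bijective (fun j => M i j - M k j).
  by apply: inj_card_bij; [exact: h | rewrite card_Fp // card_ord].
by rewrite [RHS](reindex (fun j => M i j - M k j)) //; exists g'.
Qed.

(** * Circulant matrices and the equivalence *)

Lemma circulant_conv (p : nat) (hp : prime p) (M : 'M['F_p]_p) : circulant M ->
  exists f : 'F_p -> 'F_p, forall i j : 'I_p, M i j = f (j%:R - i%:R).
Proof.
move=> hM; exists (fun x => M (Ordinal (prime_gt0 hp)) (cast_ord (Fp_cast hp) x)) => i j.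
have -> : j%:R - i%:R = (j + p - i)%:R :> 'F_p.
  by rewrite natrB ?natrD ?pchar_Fp_0 ?addr0 // (leq_trans (ltnW (ltn_ord i))) ?leq_addl.
by apply: hM; rewrite /= val_Fp_nat // subn0 modnDr modn_mod.
Qed.

Theorem theorem5p1 (p : nat) (hp : prime p) (hp3 : (3 <= p)%N)
    (M : 'M['F_p]_p) (hM : circulant M) :
  complex_hadamard (expmx M) <->
  exists a b c : 'F_p, a != 0 /\
    forall j : 'I_p, M (Ordinal (prime_gt0 hp)) j = a * (j%:R) ^+ 2 + b * j%:R + c.
Proof.
have [f hf] := circulant_conv hp hM.
have castK (x : 'F_p) : (cast_ord (Fp_cast hp) x)%:R = x by rewrite /= natr_Zp.
have natr_inj : injective (fun j : 'I_p => j%:R : 'F_p).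
  move=> i j /(congr1 (@nat_of_ord _)); rewrite !val_Fp_nat // !modn_small //.
  exact: val_inj.
have two : 2%:R != 0 :> 'F_p.
  by rewrite -(dvdn_pcharf (pchar_Fp hp)); apply/negP => /dvdn_leq; lia.
apply: iff_trans (complex_hadamard_expmx M hp hp3) _; split=> [h|[a [b [c [a0 h]]]] i k ik].
  have fplanar : planar f.
    move=> d d0 x y hxy.
    (* Rows 0 and [d], read in column [x + d], differ by [f (x + d) - f x]. *)
    have ik : Ordinal (prime_gt0 hp) != cast_ord (Fp_cast hp) d.
      by apply: contraNneq d0 => hd; rewrite -(castK d) -hd.
    have := h _ _ ik (cast_ord (Fp_cast hp) (x + d)) (cast_ord (Fp_cast hp) (y + d)).
    rewrite !hf !castK !addrK /= !subr0 => /(_ hxy) /(congr1 (fun i : 'I_p => i%:R : 'F_p)).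
    by rewrite !castK => /addIr.
  have [a [b [c habc]]] :=
    no_three_collinear_quadratic (planar_no_three_collinear hp hp3 fplanar) two.
  exists a, b, c; split=> [|j]; last by rewrite hf subr0 habc.
  (* With [a = 0] the function would be affine and its differences constant. *)
  apply/eqP => a0; have /eqP[] := oner_neq0 'F_p.
  apply: (fplanar 1 (oner_neq0 _) 1 0).
  by rewrite !habc a0; ring.
have habc x : f x = a * x ^+ 2 + b * x + c.
  by have := h (cast_ord (Fp_cast hp) x); rewrite hf castK subr0.
have ki : k%:R - i%:R != 0 :> 'F_p.
  by rewrite subr_eq0; apply: contra ik => /eqP/natr_inj->.
move=> x y; rewrite !hf !habc => hxy; apply: natr_inj.
(* The difference of rows [i] and [k] is affine in the column, with nonzero leading coefficient
   [2 * a * (k - i)]. *)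
apply: (mulfI (mulf_neq0 (mulf_neq0 two a0) ki)).
apply: (addIr (a * (i%:R ^+ 2 - k%:R ^+ 2) + b * (k%:R - i%:R))).
move: hxy; set X : 'F_p := x%:R; set Y : 'F_p := y%:R.
set I : 'F_p := i%:R; set K : 'F_p := k%:R.
move=> hxy; transitivity
  (a * (X - I) ^+ 2 + b * (X - I) + c - (a * (X - K) ^+ 2 + b * (X - K) + c)).
  by ring.
by rewrite hxy; ring.
Qed.
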